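(* Let $\mathbf V$ be a congruence-modular variety of algebras and $A\in\mathbf V$. The assignment $$\mathbf E_{\mathbf V}(Q,M)=\mathbf E_{\mathbf V}(A\ltimes Q,{}_{\pi_Q}\mathrm{Res}\,M)$$ for $Q\in\mathrm{Ov}[A,\mathbf V]$ and $M\in\mathrm{Ab}[A,\mathbf V]$, together with the maps $[\mathcal E]\mapsto[\mathcal E]r:=[\mathcal E](A\ltimes r)$ from $\mathbf E_{\mathbf V}(Q,M)$ to $\mathbf E_{\mathbf V}(Q',M)$ for homomorphisms $r:Q'\to Q$ of $\mathrm{Ov}[A,\mathbf V]$, and the maps $[\mathcal E]\mapsto\dot g[\mathcal E]:=({}_{\pi_Q}\mathrm{Res}\,\dot g)[\mathcal E]$ from $\mathbf E_{\mathbf V}(Q,M)$ to $\mathbf E_{\mathbf V}(Q,M')$ for homomorphisms $\dot g:M\to M'$ of $\mathrm{Ab}[A,\mathbf V]$, defines a bifunctor $$\mathbf E_{\mathbf V}:\mathrm{Ov}[A,\mathbf V]^{\mathrm{op}}\times\mathrm{Ab}[A,\mathbf V]\to\mathbf{Ab},$$ where $\mathbf{Ab}$ is the category of abelian groups.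
   Context: $\mathrm{Clo}_n\mathbf V$ is the set of $n$-ary terms of $\mathbf V$ modulo identities of $\mathbf V$; $v'\mathbf v$ denotes composition, $\mathbf v(\mathbf a)=\langle v_1(\mathbf a),\ldots\rangle$, and functions apply to tuples componentwise. For $A\in\mathbf V$: an $A$-set $S$ is a family of sets $({}_aS)_{a\in A}$; an $A$-function $f:S\to S'$ is a family of functions ${}_af:{}_aS\to{}_aS'$; ${}_{\mathbf a}S={}_{a_1}S\times\cdots\times{}_{a_n}S$. An $A$-overalgebra $Q$ is an $A$-set with functions $\omega^Q_{\mathbf a}:{}_{\mathbf a}Q\to{}_{\omega(\mathbf a)}Q$ for each $n$-ary basic operation $\omega$ and $\mathbf a\in A^n$; homomorphisms are $A$-functions commuting with these. Its total algebra $A\ltimes Q$ is the set of pairs $\langle a,q\rangle$ ($q\in{}_aQ$) with $\omega(\langle a_1,q_1\rangle,\ldots)=\langle\omega(\mathbf a),\omega^Q_{\mathbf a}(\mathbf q)\rangle$, with projection $\pi_Q:A\ltimes Q\to A$; a homomorphism $r:Q'\to Q$ induces $A\ltimes r:\langle a,q\rangle\mapsto\langle a,{}_ar(q)\rangle$. $Q$ is totally in $\mathbf V$ if $A\ltimes Q\in\mathbf V$, and then $v^Q_{\mathbf a}$ is defined for $v\in\mathrm{Clo}_n\mathbf V$ by $v(\langle a_1,q_1\rangle,\ldots)=\langle v(\mathbf a),v^Q_{\mathbf a}(\mathbf q)\rangle$. $\mathrm{Ov}[A,\mathbf V]$ is the category of $A$-overalgebras totally in $\mathbf V$. A pointed $A$-overalgebra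 has basepoints preserved by all operations. An abelian group $A$-overalgebra $M$ has abelian group structures on each ${}_aM$ such that all $\omega^M_{\mathbf a}$ are group homomorphisms; it is pointed by the zeros. $\mathrm{Ab}[A,\mathbf V]$ is the category of those totally in $\mathbf V$, with overalgebra homomorphisms that are componentwise group homomorphisms. For a homomorphism $f:X\to A$, ${}_f\mathrm{Res}\,M$ is the $X$-overalgebra with ${}_x({}_f\mathrm{Res}\,M)={}_{f(x)}M$, $\omega^{{}_f\mathrm{Res}M}_{\mathbf x}=\omega^M_{f(\mathbf x)}$, and ${}_x({}_f\mathrm{Res}\,\dot g)={}_{f(x)}\dot g$. For a congruence $\kappa$ of $E$, $\kappa^*$ is the pointed $E$-overalgebra with ${}_e\kappa^*=\{e':e\mathrel\kappa e'\}$, basepoint $e$, $\omega^{\kappa^*}_{\mathbf e}(\mathbf c)=\omega(\mathbf c)$. An extension in $\mathbf V$ of $A$ by $M$ is $\mathcal E=\langle\chi,E,\pi\rangle$ with $E\in\mathbf V$, $\pi:E\to A$ an onto homomorphism, $\chi:{}_\pi\mathrm{Res}\,M\to(\ker\pi)^*$ an isomorphism of pointed $E$-overalgebras. An equivalence from $\mathcal E$ to $\langle\tilde\chi,\tilde E,\tilde\pi\rangle$ is a homomorphism $\gamma:E\to\tilde E$ with $\pi=\tilde\pi\gamma$ and $\gamma({}_e\chi(m))={}_{\gamma(e)}\tilde\chi(m)$ for all $e\in E$, $m\in{}_{\pi(e)}M$. $\mathbf E_{\mathbf V}(A,M)$ is the set of equivalence classes $[\mathcal E]$. A section is a function $\sigma:A\to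 E$ with $\pi\sigma=1_A$; the factor set of $\mathcal E$ with respect to $\sigma$ is $\mathrm f^{\mathcal E,\sigma}[v;\mathbf a]={}_{\sigma(v(\mathbf a))}\chi^{-1}(v(\sigma(\mathbf a)))\in{}_{v(\mathbf a)}M$, for $v\in\mathrm{Clo}_n\mathbf V$, $\mathbf a\in A^n$. Factor sets of extensions of $A$ by $M$ are exactly the families $\mathrm f[v;\mathbf a]\in{}_{v(\mathbf a)}M$ with $\mathrm f[v'\mathbf v;\mathbf a]=v'^M_{\mathbf v(\mathbf a)}\langle\mathrm f[v_1;\mathbf a],\ldots,\mathrm f[v_{n'};\mathbf a]\rangle+\mathrm f[v';\mathbf v(\mathbf a)]$ always; two of them give equivalent extensions iff they differ by some $[v;\mathbf a]\mapsto v^M_{\mathbf a}(\delta[a_1],\ldots,\delta[a_n])-\delta[v(\mathbf a)]$ with $\delta[a]\in{}_aM$ for $a\in A$; $\mathbf E_{\mathbf V}(A,M)$ is an abelian group under pointwise addition of representing factor sets. Compositions. For a homomorphism $g:A'\to A$ in $\mathbf V$, $[\mathcal E]g=[\mathcal Eg]\in\mathbf E_{\mathbf V}(A',{}_g\mathrm{Res}\,M)$, where $\mathcal Eg=\langle\chi',E',\pi'\rangle$, $E'=\{\langle e,a'\rangle\in E\times A':\pi(e)=g(a')\}$, $\pi'\langle e,a'\rangle=a'$, ${}_{\langle e,a'\rangle}\chi'(m)=\langle{}_e\chi(m),a'\rangle$. For a homomorphism $\dot g:M\to M'$ in $\mathrm{Ab}[A,\mathbf V]$, $\dot g[\mathcal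 E]\in\mathbf E_{\mathbf V}(A,M')$ is the class whose representing factor set is $\dot g\,\mathrm f^{\mathcal E,\sigma}$, i.e. $[v;\mathbf a]\mapsto{}_{v(\mathbf a)}\dot g(\mathrm f^{\mathcal E,\sigma}[v;\mathbf a])$, for any section $\sigma$. *)

(* Defs.v *)
From HB Require Import structures.
From mathcomp Require Import all_boot all_algebra.
From mathcomp Require Import boolp.

Set Implicit Arguments.
Unset Strict Implicit.
Unset Printing Implicit Defensive.

Import GRing.Theory.
Local Open Scope ring_scope.

Record category := Category {
  obj :> Type;
  mor : obj -> obj -> Type;
  idm : forall x, mor x x;
  comp : forall x y z, mor y z -> mor x y -> mor x z;
  comp1m : forall x y (f : mor x y), comp (idm y) f = f;
  compm1 : forall x y (f : mor x y), comp f (idm x) = f;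
  compA : forall x y z t (h : mor z t) (g : mor y z) (f : mor x y),
    comp h (comp g f) = comp (comp h g) f }.

Definition op_cat (C : category) : category :=
  @Category C (fun x y => mor y x) (@idm C) (fun x y z g f => comp f g)
    (fun x y f => compm1 f) (fun x y f => comp1m f)
    (fun x y z t h g f => esym (compA f g h)).

Section ProductCategory.
Variables C D : category.

Let pmor (x y : C * D) : Type := (mor x.1 y.1 * mor x.2 y.2)%type.
Let pid (x : C * D) : pmor x x := (idm x.1, idm x.2).
Let pcomp (x y z : C * D) (g : pmor y z) (f : pmor x y) : pmor x z :=
  (comp g.1 f.1, comp g.2 f.2).

Lemma prod_comp1m x y (f : pmor x y) : pcomp (pid y) f = f.
Proof. by case: f => f1 f2; rewrite /pcomp /= !comp1m. Qed.

Lemma prod_compm1 x y (f : pmor x y) : pcomp f (pid x) = f.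
Proof. by case: f => f1 f2; rewrite /pcomp /= !compm1. Qed.

Lemma prod_compA x y z t (h : pmor z t) (g : pmor y z) (f : pmor x y) :
  pcomp h (pcomp g f) = pcomp (pcomp h g) f.
Proof. by rewrite /pcomp /= !compA. Qed.

Definition prod_cat : category := Category prod_comp1m prod_compm1 prod_compA.

End ProductCategory.

(* Functors with prescribed object map [F0]. *)
Record functor (C D : category) (F0 : C -> D) := Functor {
  fmap :> forall x y : C, mor x y -> mor (F0 x) (F0 y);
  fmap_id : forall x, fmap (idm x) = idm (F0 x);
  fmap_comp : forall x y z (g : mor y z) (f : mor x y),
    fmap (comp g f) = comp (fmap g) (fmap f) }.

(* Classes of extensions form a type one universe above the carriers of
   algebras and hence of the [zmodType]s used as coefficients, so they cannot
   themselves carry a [zmodType] structure; whence this copy of the notion. *)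
Record ab_law (T : Type) := AbLaw {
  gadd : T -> T -> T;
  gzero : T;
  gopp : T -> T;
  gaddA : associative gadd;
  gaddC : commutative gadd;
  gadd0 : left_id gzero gadd;
  gaddN : left_inverse gzero gopp gadd }.

Record ab_group := AbGroup { gsort :> Type; glaw : ab_law gsort }.

Record ab_group_hom (G H : ab_group) := AbGroupHom {
  gfun :> G -> H;
  gfunD : forall x y, gfun (gadd (glaw G) x y) = gadd (glaw H) (gfun x) (gfun y) }.

Lemma ab_group_hom_ext G H (f g : ab_group_hom G H) : f =1 g -> f = g.
Proof.
case: f g => f fD [g gD] /= /funext fg; subst g.
by congr AbGroupHom; exact: Prop_irrelevance.
Qed.

Definition ab_group_id (G : ab_group) : ab_group_hom G G :=
  @AbGroupHom G G id (fun x y => erefl).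

Lemma ab_group_comp_subproof G H K (g : ab_group_hom H K) (f : ab_group_hom G H)
    (x y : G) :
  g (f (gadd (glaw G) x y)) = gadd (glaw K) (g (f x)) (g (f y)).
Proof. by rewrite !gfunD. Qed.

Definition ab_group_comp G H K (g : ab_group_hom H K) (f : ab_group_hom G H) :
  ab_group_hom G K :=
  @AbGroupHom G K (fun x => g (f x)) (ab_group_comp_subproof g f).

Definition ab_group_cat : category :=
  @Category ab_group ab_group_hom ab_group_id ab_group_comp
    (fun G H f => ab_group_hom_ext (f := ab_group_comp (ab_group_id H) f) (g := f)
                    (fun x => erefl))
    (fun G H f => ab_group_hom_ext (f := ab_group_comp f (ab_group_id G)) (g := f)
                    (fun x => erefl))
    (fun G H K L h g f =>
       ab_group_hom_ext (f := ab_group_comp h (ab_group_comp g f))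
                        (g := ab_group_comp (ab_group_comp h g) f)
                    (fun x => erefl)).

Definition cast (T : Type) (P : T -> Type) (a b : T) (e : a = b) (x : P a) : P b :=
  eq_rect a P x b e.

Lemma existT_inj (T : Type) (P : T -> Type) (a : T) (x y : P a) :
  existT P a x = existT P a y -> x = y.
Proof.
move=> e; have := projT2_eq e.
by rewrite (Prop_irrelevance (projT1_eq e) erefl).
Qed.

Lemma castE (T : Type) (P : T -> Type) (a b : T) (e : a = b) (x : P a) :
  existT P b (cast e x) = existT P a x.
Proof. by case: b / e. Qed.

Lemma existT_map (T U : Type) (P : U -> Type) (f : T -> U) (a b : T)
    (x : P (f a)) (y : P (f b)) :
  existT (fun t => P (f t)) a x = existT (fun t => P (f t)) b y ->
  existT P (f a) x = existT P (f b) y.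
Proof.
exact: (congr1 (fun z : {t : T & P (f t)} => existT P (f (projT1 z)) (projT2 z))).
Qed.

Lemma sig_val_inj (T : Type) (P : T -> Prop) (x y : {t : T | P t}) :
  sval x = sval y -> x = y.
Proof.
case: x y => x px [y py] /= e; subst y; congr exist; exact: Prop_irrelevance.
Qed.

Record signature := Signature { symbol :> Type; arity : symbol -> nat }.

Section UniversalAlgebra.
Variable S : signature.

Record algebra := Algebra {
  carrier :> Type;
  opn : forall w : S, ('I_(arity w) -> carrier) -> carrier }.

Record hom (A B : algebra) := Hom {
  hfun :> A -> B;
  hopn : forall (w : S) (a : 'I_(arity w) -> A),
    hfun (opn a) = opn (fun i => hfun (a i)) }.

Inductive term (n : nat) : Type :=
| Var of 'I_n
| App (w : S) of ('I_(arity w) -> term n).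

Fixpoint eval (B : algebra) (n : nat) (t : term n) (a : 'I_n -> B) : B :=
  match t with
  | Var i => a i
  | App w ts => opn (fun j => eval (ts j) a)
  end.

Lemma hom_eval (A B : algebra) (f : hom A B) n (t : term n) (a : 'I_n -> A) :
  f (eval t a) = eval t (fun i => f (a i)).
Proof.
elim: t => [//|w ts IH] /=; rewrite hopn; congr opn.
by apply: funext => j; exact: IH.
Qed.

(* A variety is presented by the pairs of terms it equates, so membership is
   satisfaction of identities; algebras, and members of a variety, may be empty. *)
Definition variety := forall n, term n -> term n -> Prop.

Definition in_variety (V : variety) (B : algebra) : Prop :=
  forall n (s t : term n), V n s t -> forall a : 'I_n -> B, eval s a = eval t a.

Record valgebra (V : variety) := VAlgebra {
  valg :> algebra;
  valgP : in_variety V valg }.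

Definition identity_of (V : variety) n (s t : term n) : Prop :=
  forall (B : valgebra V) (a : 'I_n -> B), eval s a = eval t a.

(* An element of Clo_n V is the set of all terms that agree with a given one in
   every member of [V]; it acts through a chosen element, and [clo_evalE] shows
   that the choice is immaterial. *)
Definition Clo (V : variety) n : Type :=
  {c : term n -> Prop | exists t, c = identity_of V t}.

Definition clo_class (V : variety) n (t : term n) : Clo V n :=
  exist _ (identity_of V t) (ex_intro _ t erefl).

Definition clo_repr (V : variety) n (v : Clo V n) : term n :=
  sval (cid (svalP v)).

Definition clo_eval (V : variety) (B : valgebra V) n (v : Clo V n)
  (a : 'I_n -> B) : B := eval (clo_repr v) a.

Lemma clo_evalE (V : variety) (B : valgebra V) n (t : term n) (a : 'I_n -> B) :
  clo_eval (clo_class V t) a = eval t a.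
Proof.
rewrite /clo_eval /clo_repr; case: cid => s /= st.
have : identity_of V s s by [].
by rewrite -st => /(_ B a).
Qed.

Lemma hom_clo_eval (V : variety) (A B : valgebra V) (f : hom A B) n
    (v : Clo V n) (a : 'I_n -> A) :
  f (clo_eval v a) = clo_eval v (fun i => f (a i)).
Proof. exact: hom_eval. Qed.

Record congruence (B : algebra) := Congruence {
  crel :> B -> B -> Prop;
  crefl : forall x, crel x x;
  csym : forall x y, crel x y -> crel y x;
  ctrans : forall x y z, crel x y -> crel y z -> crel x z;
  copn : forall (w : S) (a b : 'I_(arity w) -> B),
    (forall i, crel (a i) (b i)) -> crel (opn a) (opn b) }.

Definition cong_le (B : algebra) (al be : congruence B) : Prop :=
  forall x y, al x y -> be x y.

#[local] Obligation Tactic := idtac.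

Program Definition cong_meet (B : algebra) (al be : congruence B) : congruence B :=
  @Congruence B (fun x y => al x y /\ be x y) _ _ _ _.
Next Obligation. by move=> *; split; apply: crefl. Qed.
Next Obligation. by move=> B al be x y [? ?]; split; apply: csym. Qed.
Next Obligation.
move=> B al be x y z [xy xy'] [yz yz'].
by split; [apply: ctrans xy yz|apply: ctrans xy' yz'].
Qed.
Next Obligation. by move=> B al be w a b ab; split; apply: copn => i; case: (ab i). Qed.

Program Definition cong_join (B : algebra) (al be : congruence B) : congruence B :=
  @Congruence B
    (fun x y => forall th : congruence B, cong_le al th -> cong_le be th -> th x y)
    _ _ _ _.
Next Obligation. by move=> B al be x th _ _; exact: crefl. Qed.
Next Obligation. by move=> B al be x y xy th ? ?; apply: csym; apply: xy. Qed.
Next Obligation.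
by move=> B al be x y z xy yz th ? ?; apply: (ctrans (y := y)); [apply: xy|apply: yz].
Qed.
Next Obligation. by move=> B al be w a b ab th ? ?; apply: copn => i; apply: ab. Qed.

Definition modular_congruences (B : algebra) : Prop :=
  forall al be ga : congruence B, cong_le al ga ->
  forall x y, cong_join al (cong_meet be ga) x y <->
              cong_meet (cong_join al be) ga x y.

Definition congruence_modular (V : variety) : Prop :=
  forall B : valgebra V, modular_congruences B.

Program Definition ker (A B : algebra) (f : hom A B) : congruence A :=
  @Congruence A (fun x y => f x = f y) _ _ _ _.
Next Obligation. by []. Qed.
Next Obligation. by []. Qed.
Next Obligation. by move=> A B f x y z /= -> ->. Qed.
Next Obligation.
move=> A B f w a b ab /=; rewrite !hopn; congr opn; exact: funext.
Qed.

Record overalgebra (A : algebra) := Overalgebra {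
  fib :> A -> Type;
  oop : forall (w : S) (a : 'I_(arity w) -> A), (forall i, fib (a i)) -> fib (opn a) }.
Arguments oop {A} o {w} a _.

Record ohom (A : algebra) (P Q : overalgebra A) := OHom {
  ofun :> forall a, P a -> Q a;
  ofun_op : forall (w : S) (a : 'I_(arity w) -> A) (q : forall i, P (a i)),
    ofun (oop P a q) = oop Q a (fun i => ofun (q i)) }.

Definition total (A : algebra) (Q : overalgebra A) : algebra :=
  @Algebra {a : A & Q a} (fun w x =>
    existT Q (opn (fun i => projT1 (x i)))
             (oop Q (fun i => projT1 (x i)) (fun i => projT2 (x i)))).

Definition total_proj (A : algebra) (Q : overalgebra A) : hom (total Q) A :=
  @Hom (total Q) A (fun x => projT1 x) (fun w x => erefl).

Lemma total_hom_subproof (A : algebra) (P Q : overalgebra A) (r : ohom P Q)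
    (w : S) (x : 'I_(arity w) -> total P) :
  (fun z : total P => existT Q (projT1 z) (r _ (projT2 z)) : total Q) (opn x) =
  opn (fun i => existT Q (projT1 (x i)) (r _ (projT2 (x i))) : total Q).
Proof. by rewrite /= ofun_op. Qed.

Definition total_hom (A : algebra) (P Q : overalgebra A) (r : ohom P Q) :
  hom (total P) (total Q) := @Hom (total P) (total Q) (fun z => existT Q (projT1 z) (r _ (projT2 z)))
    (@total_hom_subproof A P Q r).

Definition oid (A : algebra) (P : overalgebra A) : ohom P P :=
  @OHom A P P (fun a => id) (fun w a q => erefl).

Lemma ocomp_subproof (A : algebra) (P Q R : overalgebra A) (g : ohom Q R)
    (f : ohom P Q) (w : S) (a : 'I_(arity w) -> A) (q : forall i, P (a i)) :
  g _ (f _ (oop P a q)) = oop R a (fun i => g _ (f _ (q i))).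
Proof. by rewrite !ofun_op. Qed.

Definition ocomp (A : algebra) (P Q R : overalgebra A) (g : ohom Q R)
  (f : ohom P Q) : ohom P R :=
  @OHom A P R (fun a q => g a (f a q)) (ocomp_subproof g f).

Lemma ohom_ext (A : algebra) (P Q : overalgebra A) (f g : ohom P Q) :
  (forall a x, f a x = g a x) -> f = g.
Proof.
case: f g => f fP [g gP] /= fg.
have e : f = g by apply: functional_extensionality_dep => a; apply: funext.
by subst g; congr OHom; exact: Prop_irrelevance.
Qed.

Record pointed_overalgebra (A : algebra) := PointedOveralgebra {
  pov :> overalgebra A;
  point : forall a, pov a;
  point_op : forall (w : S) (a : 'I_(arity w) -> A),
    oop pov a (fun i => point (a i)) = point (opn a) }.
Arguments point {A} p a.

Record pointed_iso (A : algebra) (P Q : pointed_overalgebra A) := PointedIso {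
  iso_fun :> ohom P Q;
  iso_point : forall a, iso_fun a (point P a) = point Q a;
  iso_inv : forall a, Q a -> P a;
  iso_funK : forall a, cancel (iso_fun a) (@iso_inv a);
  iso_invK : forall a, cancel (@iso_inv a) (iso_fun a) }.
Arguments iso_inv {A P Q} p a _ : rename.

(* kappa^* in the usual notation. *)
Definition star_overalgebra (B : algebra) (k : congruence B) : overalgebra B :=
  @Overalgebra B (fun e => {e' : B | k e e'})
    (fun w e c => exist _ (opn (fun i => sval (c i)))
                          (copn (fun i => svalP (c i)))).

Lemma star_point_op (B : algebra) (k : congruence B) (w : S)
    (e : 'I_(arity w) -> B) :
  oop (star_overalgebra k) e (fun i => exist _ (e i) (crefl k (e i))) =
  exist _ (opn e) (crefl k (opn e)).
Proof. exact: sig_val_inj. Qed.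

Definition star (B : algebra) (k : congruence B) : pointed_overalgebra B :=
  @PointedOveralgebra B (star_overalgebra k)
    (fun e => exist _ e (crefl k e)) (@star_point_op B k).

(* [aopD] says that each operation is a homomorphism from the product group. *)
Record ab_overalgebra (A : algebra) := AbOveralgebra {
  afib :> A -> zmodType;
  aop : forall (w : S) (x : 'I_(arity w) -> A), (forall i, afib (x i)) -> afib (opn x);
  aopD : forall (w : S) (x : 'I_(arity w) -> A) (m m' : forall i, afib (x i)),
    aop (fun i => m i + m' i) = aop m + aop m' }.
Arguments aop {A} a {w} x _.

Definition ab_ov (A : algebra) (M : ab_overalgebra A) : overalgebra A :=
  @Overalgebra A (fun a => M a : Type) (@aop A M).

Lemma ab_point_op (A : algebra) (M : ab_overalgebra A) (w : S)
    (a : 'I_(arity w) -> A) :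
  oop (ab_ov M) a (fun i => 0 : M (a i)) = 0 :> M _.
Proof.
have /= := @aopD A M w a (fun i => 0) (fun i => 0).
rewrite (_ : (fun i => _) = (fun i => 0 : M (a i))); last first.
  by apply: functional_extensionality_dep => i; rewrite addr0.
by move/eqP; rewrite -subr_eq0 opprD addrA subrr sub0r oppr_eq0 => /eqP.
Qed.

Definition ab_pointed (A : algebra) (M : ab_overalgebra A) : pointed_overalgebra A :=
  @PointedOveralgebra A (ab_ov M) (fun a => 0 : M a) (@ab_point_op A M).

Record ab_hom (A : algebra) (M N : ab_overalgebra A) := AbHom {
  ahom :> ohom (ab_ov M) (ab_ov N);
  ahomD : forall a (x y : M a), ahom a (x + y) = (ahom a x : N a) + ahom a y }.

Lemma ab_hom_ext (A : algebra) (M N : ab_overalgebra A) (f g : ab_hom M N) :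
  (forall a x, f a x = g a x) -> f = g.
Proof.
case: f g => f fP [g gP] /= fg; have e : f = g by exact: ohom_ext.
subst g.
by congr AbHom; exact: Prop_irrelevance.
Qed.

Definition ab_hom_id (A : algebra) (M : ab_overalgebra A) : ab_hom M M :=
  @AbHom A M M (oid (ab_ov M)) (fun a x y => erefl).

Lemma ab_hom_comp_subproof (A : algebra) (M N L : ab_overalgebra A)
    (g : ab_hom N L) (f : ab_hom M N) a (x y : M a) :
  ocomp g f a (x + y) = (ocomp g f a x : L a) + ocomp g f a y.
Proof. by rewrite /= !ahomD. Qed.

Definition ab_hom_comp (A : algebra) (M N L : ab_overalgebra A)
  (g : ab_hom N L) (f : ab_hom M N) : ab_hom M L :=
  @AbHom A M L (ocomp g f) (ab_hom_comp_subproof g f).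

Record ab_iso (A : algebra) (M N : ab_overalgebra A) := AbIso {
  ab_iso_fun :> ab_hom M N;
  ab_iso_inv : forall a, N a -> M a;
  ab_iso_funK : forall a, cancel (ab_iso_fun a) (@ab_iso_inv a);
  ab_iso_invK : forall a, cancel (@ab_iso_inv a) (ab_iso_fun a) }.
Arguments ab_iso_inv {A M N} i a _ : rename.

(* The operation of [M] at [f \o x] lands in the fibre over [opn (f \o x)],
   which is only propositionally [f (opn x)]. *)
Definition res_op (X A : algebra) (f : hom X A) (M : ab_overalgebra A) (w : S)
  (x : 'I_(arity w) -> X) (m : forall i, M (f (x i))) : M (f (opn x)) :=
  cast (P := fun a => M a) (esym (hopn f x)) (aop M (fun i => f (x i)) m).

Lemma castD (A : algebra) (M : ab_overalgebra A) (a b : A) (e : a = b)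
    (x y : M a) :
  cast (P := fun a => M a) e (x + y) =
  cast (P := fun a => M a) e x + cast (P := fun a => M a) e y.
Proof. by case: b / e. Qed.

Lemma res_opD (X A : algebra) (f : hom X A) (M : ab_overalgebra A) (w : S)
  (x : 'I_(arity w) -> X) (m m' : forall i, M (f (x i))) :
  res_op (fun i => m i + m' i) = res_op m + res_op m'.
Proof. by rewrite /res_op aopD castD. Qed.

Definition res (X A : algebra) (f : hom X A) (M : ab_overalgebra A) :
  ab_overalgebra X :=
  @AbOveralgebra X (fun x => M (f x)) (@res_op X A f M) (@res_opD X A f M).

Lemma res_hom_op (X A : algebra) (f : hom X A) (M N : ab_overalgebra A)
    (g : ab_hom M N) (w : S) (x : 'I_(arity w) -> X)
    (m : forall i, ab_ov (res f M) (x i)) :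
  g (f (opn x)) (oop (ab_ov (res f M)) x m) =
  oop (ab_ov (res f N)) x (fun i => g (f (x i)) (m i)).
Proof.
rewrite /= /res_op; have /= <- := ofun_op g (a := fun i => f (x i)) m.
by case: _ / (esym (hopn f x)).
Qed.

Definition res_hom (X A : algebra) (f : hom X A) (M N : ab_overalgebra A)
  (g : ab_hom M N) : ab_hom (res f M) (res f N) :=
  @AbHom X (res f M) (res f N)
    (@OHom X (ab_ov (res f M)) (ab_ov (res f N)) (fun x => g (f x))
       (@res_hom_op X A f M N g))
    (fun x => @ahomD A M N g (f x)).

Record ovV (V : variety) (A : valgebra V) := OvV {
  ovV_ov :> overalgebra A;
  ovV_total : in_variety V (total ovV_ov) }.

Record abV (V : variety) (A : valgebra V) := AbV {
  abV_ab :> ab_overalgebra A;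
  abV_total : in_variety V (total (ab_ov abV_ab)) }.

Definition totalV (V : variety) (A : valgebra V) (Q : ovV A) : valgebra V :=
  VAlgebra (@ovV_total V A Q).

Definition Ov (V : variety) (A : valgebra V) : category :=
  @Category (ovV A) (fun P Q => ohom P Q) (fun P => oid P)
    (fun P Q R g f => ocomp g f)
    (fun P Q f => ohom_ext (f := ocomp (oid Q) f) (g := f) (fun a x => erefl))
    (fun P Q f => ohom_ext (f := ocomp f (oid P)) (g := f) (fun a x => erefl))
    (fun P Q R T h g f => ohom_ext (f := ocomp h (ocomp g f))
                         (g := ocomp (ocomp h g) f) (fun a x => erefl)).

Definition Ab (V : variety) (A : valgebra V) : category :=
  @Category (abV A) (fun M N => ab_hom M N) (fun M => ab_hom_id M)
    (fun M N L g f => ab_hom_comp g f)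
    (fun M N f => ab_hom_ext (f := ab_hom_comp (ab_hom_id N) f) (g := f) (fun a x => erefl))
    (fun M N f => ab_hom_ext (f := ab_hom_comp f (ab_hom_id M)) (g := f) (fun a x => erefl))
    (fun M N L K h g f => ab_hom_ext (f := ab_hom_comp h (ab_hom_comp g f))
                         (g := ab_hom_comp (ab_hom_comp h g) f) (fun a x => erefl)).

Lemma existT_res_op (X A : algebra) (f : hom X A) (M : ab_overalgebra A) (w : S)
    (x : 'I_(arity w) -> X) (m : forall i, M (f (x i))) :
  existT (fun a => M a : Type) (f (opn x)) (res_op m) =
  existT (fun a => M a : Type) _ (aop M (fun i => f (x i)) m).
Proof. exact: castE. Qed.

Lemma existT_aop_cast (A : algebra) (M : ab_overalgebra A) (w : S)
    (a b : 'I_(arity w) -> A) (h : forall i, a i = b i) (m : forall i, M (a i)) :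
  existT (fun a => M a : Type) _ (aop M a m) =
  existT (fun a => M a : Type) _
    (aop M b (fun i => cast (P := fun a => M a) (h i) (m i))).
Proof.
have e := funext h; subst b; congr existT; congr aop.
by apply: functional_extensionality_dep => i; rewrite (Prop_irrelevance (h i) erefl).
Qed.

Lemma res_in_variety (V : variety) (X A : valgebra V) (f : hom X A) (M : abV A) :
  in_variety V (total (ab_ov (res f M))).
Proof.
pose T := total (ab_ov (res f M)).
pose h (z : T) : total (ab_ov M) := existT _ (f (projT1 z)) (projT2 z).
have hP (w : S) (z : 'I_(arity w) -> T) : h (opn z) = opn (fun i => h (z i)).
  exact: existT_res_op.
move=> n s t Vst a.
have e1 : projT1 (eval s a) = projT1 (eval t a).
  have pE u := hom_eval (total_proj (ab_ov (res f M))) u a.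
  apply: etrans (pE s) (etrans _ (esym (pE t))); exact: valgP.
have e2 : h (eval s a) = h (eval t a).
  have hE u := hom_eval (Hom hP) u a.
  apply: etrans (hE s) (etrans _ (esym (hE t))); exact: abV_total.
case: (eval s a) (eval t a) e1 e2 => x m [y m'] /= e; subst y.
by move=> e2; congr existT; exact: existT_inj e2.
Qed.

Definition resV (V : variety) (X A : valgebra V) (f : hom X A) (M : abV A) : abV X :=
  AbV (@res_in_variety V X A f M).

Record extension (V : variety) (A : valgebra V) (M : abV A) := Extension {
  ext_alg :> valgebra V;
  ext_pi : hom ext_alg A;
  ext_onto : forall a, exists e, ext_pi e = a;
  ext_chi : pointed_iso (ab_pointed (res ext_pi M)) (star (ker ext_pi)) }.

(* [m] lies over [pi e] and is moved over [pi' (g e)] before [chi'] applies. *)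
Definition equivalent (V : variety) (A : valgebra V) (M : abV A)
    (E E' : extension M) : Prop :=
  exists (g : hom E E') (gP : forall e, ext_pi E e = ext_pi E' (g e)),
  forall e (m : M (ext_pi E e)),
    g (sval (ext_chi E e m)) =
    sval (ext_chi E' (g e) (cast (P := fun a => M a) (gP e) m)).

Definition ext_class (V : variety) (A : valgebra V) (M : abV A) : Type :=
  {c : extension M -> Prop | exists E, c = equivalent E}.

Definition class_of (V : variety) (A : valgebra V) (M : abV A) (E : extension M) :
  ext_class M := exist _ (equivalent E) (ex_intro _ E erefl).

Section FactorSets.
Variables (V : variety) (A : valgebra V) (M : abV A).

Definition factor_family : Type :=
  forall n (v : Clo V n) (a : 'I_n -> A), M (clo_eval v a).

Section FactorSetOf.
Variables (E : extension M) (sigma : A -> E) (sigmaP : cancel sigma (ext_pi E)).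

Lemma factor_set_subproof n (v : Clo V n) (a : 'I_n -> A) :
  ker (ext_pi E) (sigma (clo_eval v a)) (clo_eval v (fun i => sigma (a i))).
Proof.
by rewrite /= hom_clo_eval sigmaP; congr clo_eval; apply: funext => i; rewrite sigmaP.
Qed.

(* chi^-1 lands over [pi (sigma (v a))]; the cast moves it over [v a]. *)
Definition factor_set : factor_family := fun n v a =>
  cast (P := fun a => M a) (sigmaP (clo_eval v a))
    (iso_inv (ext_chi E) (sigma (clo_eval v a))
       (exist _ (clo_eval v (fun i => sigma (a i))) (factor_set_subproof v a))).

End FactorSetOf.

(* By [ext_onto] every extension has sections, and [c] may be represented by
   several families, one for each choice of [E] and [sigma]. *)
Definition represents (c : ext_class M) (f : factor_family) : Prop :=
  exists (E : extension M) (sigma : A -> E) (sigmaP : cancel sigma (ext_pi E)),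
    c = class_of E /\ forall n (v : Clo V n) a, factor_set sigmaP v a = f n v a.

(* Extensions with the same factor set are equivalent, so this pins down [gadd G]
   when [V] is congruence-modular. *)
Definition factor_set_addition (G : ab_law (ext_class M)) : Prop :=
  forall (c c' : ext_class M) (f f' : factor_family),
    represents c f -> represents c' f' ->
    represents (gadd G c c') (fun n v a => f n v a + f' n v a).

End FactorSets.

Section Pullback.
Variables (V : variety) (A A' : valgebra V) (g : hom A' A) (M : abV A).
Variable E : extension M.

Let pcar : Type := {p : (E * A')%type | ext_pi E p.1 = g p.2}.

Lemma pull_op_subproof (w : S) (x : 'I_(arity w) -> pcar) :
  ext_pi E (opn (fun i => (sval (x i)).1)) = g (opn (fun i => (sval (x i)).2)).
Proof. by rewrite !hopn; congr opn; apply: funext => i; exact: (svalP (x i)). Qed.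

Definition pull_algebra : algebra :=
  @Algebra pcar (fun w x =>
    exist _ (opn (fun i => (sval (x i)).1), opn (fun i => (sval (x i)).2))
      (pull_op_subproof x)).

Definition pull_fst : hom pull_algebra E :=
  @Hom pull_algebra E (fun x => (sval x).1) (fun w x => erefl).

Definition pull_pi : hom pull_algebra A' :=
  @Hom pull_algebra A' (fun x => (sval x).2) (fun w x => erefl).

Lemma pull_in_variety : in_variety V pull_algebra.
Proof.
move=> n s t Vst a; apply: sig_val_inj.
have e1 : pull_fst (eval s a) = pull_fst (eval t a).
  by rewrite !hom_eval; exact: valgP.
have e2 : pull_pi (eval s a) = pull_pi (eval t a).
  by rewrite !hom_eval; exact: valgP.
rewrite /= in e1 e2.
by rewrite [LHS]surjective_pairing [RHS]surjective_pairing e1 e2.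
Qed.

Lemma pull_onto a' : exists e, pull_pi e = a'.
Proof. by have [e eP] := ext_onto E (g a'); exists (exist _ (e, a') eP). Qed.

Definition pull_coef (x : pull_algebra) (m : M (g (pull_pi x))) :
  M (ext_pi E (pull_fst x)) := cast (P := fun a => M a) (esym (svalP x)) m.

Definition pull_chi_val (x : pull_algebra) (m : M (g (pull_pi x))) : E :=
  sval (ext_chi E (pull_fst x) (pull_coef m)).

Lemma pull_chi_val_subproof (x : pull_algebra) (m : M (g (pull_pi x))) :
  ext_pi E (pull_chi_val m) = g (pull_pi x).
Proof. by rewrite -(svalP (ext_chi E (pull_fst x) (pull_coef m))) (svalP x). Qed.

Definition pull_chi_fun (x : pull_algebra)
    (m : ab_pointed (res pull_pi (resV g M)) x) : star (ker pull_pi) x :=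
  exist _ (exist _ (pull_chi_val m, pull_pi x) (pull_chi_val_subproof m)) erefl.

Lemma pull_coef_op (w : S) (x : 'I_(arity w) -> pull_algebra)
    (m : forall i, M (g (pull_pi (x i)))) :
  pull_coef (x := opn x) (oop (ab_ov (res pull_pi (resV g M))) x m) =
  oop (ab_ov (res (ext_pi E) M)) (fun i => pull_fst (x i)) (fun i => pull_coef (m i)).
Proof.
apply: (@existT_inj _ (fun a => M a : Type)).
rewrite [LHS]castE [RHS]existT_res_op.
apply: etrans (existT_map (P := fun a => M a : Type) (f := g)
  (castE (P := fun y => M (g y) : Type) (esym (hopn pull_pi x)) (res_op m))) _.
rewrite [LHS]existT_res_op.
exact: existT_aop_cast.
Qed.

Lemma pull_chi_op (w : S) (x : 'I_(arity w) -> pull_algebra)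
    (m : forall i, ab_pointed (res pull_pi (resV g M)) (x i)) :
  pull_chi_fun (oop (ab_pointed (res pull_pi (resV g M))) x m) =
  oop (star (ker pull_pi)) x (fun i => pull_chi_fun (m i)).
Proof.
apply: sig_val_inj; apply: sig_val_inj => /=; congr pair.
rewrite /pull_chi_val pull_coef_op.
have /(congr1 sval) := ofun_op (ext_chi E) (a := fun i => pull_fst (x i))
  (fun i => pull_coef (m i)).
exact.
Qed.

Lemma pull_chi_point x :
  pull_chi_fun (point (ab_pointed (res pull_pi (resV g M))) x) =
  point (star (ker pull_pi)) x.
Proof.
apply: sig_val_inj; apply: sig_val_inj => /=.
rewrite [RHS]surjective_pairing; congr pair; rewrite /pull_chi_val.
have -> : pull_coef (0 : M (g (pull_pi x))) = 0.
  by rewrite /pull_coef; case: _ / (esym (svalP x)).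
exact: (congr1 sval (iso_point (ext_chi E) (pull_fst x))).
Qed.

Lemma pull_inv_subproof (x : pull_algebra) (y : star (ker pull_pi) x) :
  ext_pi E (pull_fst x) = ext_pi E (pull_fst (sval y)).
Proof.
apply: etrans (svalP x) (etrans _ (esym (svalP (sval y)))).
exact: (congr1 g (svalP y)).
Qed.

Definition pull_chi_inv (x : pull_algebra) (y : star (ker pull_pi) x) :
    ab_pointed (res pull_pi (resV g M)) x :=
  cast (P := fun a => M a) (svalP x)
    (iso_inv (ext_chi E) (pull_fst x)
      (exist _ (pull_fst (sval y)) (pull_inv_subproof y))).

Lemma pull_chi_funK x : cancel (@pull_chi_fun x) (@pull_chi_inv x).
Proof.
move=> m; rewrite /pull_chi_inv.
have -> : exist _ (pull_fst (sval (pull_chi_fun m)))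
   (pull_inv_subproof (pull_chi_fun m)) = ext_chi E (pull_fst x) (pull_coef m).
  exact: sig_val_inj.
rewrite iso_funK /pull_coef; apply: (@existT_inj _ (fun a => M a : Type)).
by rewrite [LHS]castE [LHS]castE.
Qed.

Lemma pull_chi_invK x : cancel (@pull_chi_inv x) (@pull_chi_fun x).
Proof.
move=> y; apply: sig_val_inj; apply: sig_val_inj => /=.
rewrite [RHS]surjective_pairing; congr pair; last exact: (svalP y).
rewrite /pull_chi_val.
have -> : pull_coef (pull_chi_inv y) = iso_inv (ext_chi E) (pull_fst x)
    (exist _ (pull_fst (sval y)) (pull_inv_subproof y)).
  rewrite /pull_coef; apply: (@existT_inj _ (fun a => M a : Type)).
  by rewrite [LHS]castE [LHS]castE.
by rewrite iso_invK.
Qed.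

Definition pull_chi :
    pointed_iso (ab_pointed (res pull_pi (resV g M))) (star (ker pull_pi)) :=
  @PointedIso pull_algebra (ab_pointed (res pull_pi (resV g M))) (star (ker pull_pi))
    (@OHom _ _ _ pull_chi_fun pull_chi_op) pull_chi_point pull_chi_inv pull_chi_funK pull_chi_invK.

Definition pullback : extension (resV g M) :=
  @Extension V A' (resV g M) (VAlgebra pull_in_variety) pull_pi pull_onto pull_chi.

End Pullback.

Section Recoefficient.
Variables (V : variety) (A : valgebra V) (M N : abV A) (i : ab_iso M N).
Variable E : extension M.

Let P := ab_pointed (res (ext_pi E) N).
Let K := star (ker (ext_pi E)).

Let inv_fun (e : E) (m : P e) : ab_pointed (res (ext_pi E) M) e :=
  ab_iso_inv i (ext_pi E e) m.
Let chi_fun (e : E) (m : P e) : K e := ext_chi E e (inv_fun m).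
Let chi_inv (e : E) (y : K e) : P e := i (ext_pi E e) (iso_inv (ext_chi E) e y).

Lemma recoef_op (w : S) (x : 'I_(arity w) -> E) (m : forall j, P (x j)) :
  chi_fun (oop P x m) = oop K x (fun j => chi_fun (m j)).
Proof.
rewrite /chi_fun; have <- := ofun_op (ext_chi E) (fun j => inv_fun (m j)).
congr (ext_chi E _ _); rewrite /inv_fun.
apply: (can_inj (ab_iso_funK i (a := ext_pi E (opn x)))); rewrite ab_iso_invK.
rewrite [RHS](@res_hom_op _ _ (ext_pi E) M N i).
apply: (congr1 (oop P x)); apply: functional_extensionality_dep => j.
by rewrite ab_iso_invK.
Qed.

Lemma recoef_point e : chi_fun (point P e) = point K e.
Proof.
rewrite /chi_fun -(iso_point (ext_chi E)); congr (ext_chi E _ _).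
apply: (can_inj (ab_iso_funK i (a := ext_pi E e))); rewrite ab_iso_invK /=.
have /eqP := ahomD i (0 : M (ext_pi E e)) 0.
by rewrite addr0 -subr_eq0 opprD addrA subrr sub0r oppr_eq0 => /eqP.
Qed.

Lemma recoef_funK e : cancel (@chi_fun e) (@chi_inv e).
Proof. by move=> m; rewrite /chi_inv /chi_fun iso_funK ab_iso_invK. Qed.

Lemma recoef_invK e : cancel (@chi_inv e) (@chi_fun e).
Proof. by move=> y; rewrite /chi_fun /inv_fun /chi_inv ab_iso_funK iso_invK. Qed.

Definition recoef : extension N :=
  @Extension V A N E (ext_pi E) (ext_onto E)
    (@PointedIso E P K (@OHom _ _ _ chi_fun recoef_op) recoef_point chi_inv recoef_funK recoef_invK).

End Recoefficient.

Section OveralgebraExtensions.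
Variables (V : variety) (A : valgebra V).

Definition coef (Q : ovV A) (M : abV A) : abV (totalV Q) :=
  resV (X := totalV Q) (total_proj Q) M.

Definition EV (Q : ovV A) (M : abV A) : Type := ext_class (coef Q M).

(* Restricting along A |>< r and then along pi_Q is restricting along pi_Q';
   the fibres agree definitionally but the operations only up to transport, so
   the identification is recorded as an isomorphism with identity components. *)
Section ResTotal.
Variables (Q Q' : ovV A) (r : ohom Q' Q) (M : abV A).

Let R : abV (totalV Q') := resV (X := totalV Q') (A := totalV Q) (total_hom r) (coef Q M).

Lemma res_total_op (w : S) (x : 'I_(arity w) -> totalV Q')
    (m : forall j, ab_ov R (x j)) :
  oop (ab_ov R) x m = oop (ab_ov (coef Q' M)) x m.
Proof.
apply: (@existT_inj _ (fun a => M a : Type)).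
exact: (existT_map (P := fun a => M a : Type) (f := total_proj Q)
         (a := total_hom r (opn x)) (castE (P := fun y => M (projT1 y)) _ _)).
Qed.

Definition res_total_hom : ab_hom R (coef Q' M) :=
  @AbHom _ R (coef Q' M)
    (@OHom _ (ab_ov R) (ab_ov (coef Q' M)) (fun x m => m) res_total_op)
    (fun x m m' => erefl).

Definition res_total : ab_iso R (coef Q' M) :=
  @AbIso _ R (coef Q' M) res_total_hom (fun x m => m)
    (fun x m => erefl) (fun x m => erefl).

End ResTotal.

Definition ext_precomp (Q Q' : ovV A) (M : abV A) (E : extension (coef Q M))
    (r : ohom Q' Q) : extension (coef Q' M) :=
  recoef (res_total r M) (pullback (A := totalV Q) (A' := totalV Q') (total_hom r) E).

Definition factor_postcomp (Q : ovV A) (M M' : abV A) (g : ab_hom M M')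
    (f : factor_family (coef Q M)) : factor_family (coef Q M') :=
  fun n v a => res_hom (total_proj Q) g (clo_eval v a) (f n v a).

End OveralgebraExtensions.

End UniversalAlgebra.

Arguments oop {S A} o {w} a _ : rename.
Arguments aop {S A} a {w} x _ : rename.
Arguments point {S A} p a : rename.
Arguments iso_inv {S A P Q} p a _ : rename.
Arguments ab_iso_inv {S A M N} i a _ : rename.

(* Main.v *)
From mathcomp Require Import all_boot all_algebra.
From mathcomp Require Import boolp.
Require Import Defs.

Set Implicit Arguments.
Unset Strict Implicit.
Unset Printing Implicit Defensive.

Import GRing.Theory.
Local Open Scope ring_scope.

(** The isomorphism [chi] of an extension [E] of [A] by [M] makes the group
[M (pi e)] displace the point [e] inside its fibre: this is the relation
[shift e (a, m) x], meaning [x = chi_e m] with [a = pi e].  That [chi] is an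
isomorphism of overalgebras says that displacements commute with all
operations.  The one place where congruence-modularity enters is
[shift_add]: displacing by [m] and then by [n] displaces by [m + n], so that
the fibres of [E] are torsors.  It follows from the Shifting Lemma, applied to
the algebra of triples [(e, x, y)] of congruent elements of [E]: the difference
between [chi_e (m + n)] and [chi_(chi_e m) n], where [x = chi_e m] and
[y = chi_e n], is compatible with the operations and vanishes when [m = 0] or
[n = 0], hence always.

Given this, classes of extensions are cocycles modulo coboundaries.  A family is
a factor set iff it vanishes on variables and satisfies the composition rule for
the application of one basic operation ([represents_cocycle]); conversely such a
family twists the operations of the total algebra of [M] into an extension
having it as factor set ([represents_twisted]).  Two factor sets of one class
differ by the coboundary of the displacement between the two sections
([represents_cohomologous]), any such change is realised by moving the section
([cohomologous_represents]), and a factor set determines the class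
([represents_inj]).  So the relation [represents] identifies the classes with
the group of cocycles modulo coboundaries, and addition of factor sets makes
them a group.

The two actions become, on factor sets, reindexing along [r] and application of
[g].  Both are additive and functorial on families, so the bifunctor laws hold
on classes because a class is determined by any one of its factor sets.  That
reindexing is realised by the pullback of extensions is [represents_precomp]; it
also makes reindexing preserve cocycles and coboundaries without a
calculation. *)

(** * The Shifting Lemma *)

Section ShiftingLemma.
Variable S : signature.

(** The chain [x be z (al /\ ga) w be y] puts [(x, y)] in
[((al /\ ga) \/ be) /\ al], which modularity turns into
[(al /\ ga) \/ (be /\ al)], a congruence below [ga]. *)
Lemma shifting_lemma (B : algebra S) (al be ga : congruence B) (x y z w : B) :
  modular_congruences B -> (forall u v, al u v -> be u v -> ga u v) ->
  al x y -> al z w -> ga z w -> be x z -> be y w -> ga x y.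
Proof.
move=> modB le_ga al_xy al_zw ga_zw be_xz be_yw.
have le_al : cong_le (cong_meet al ga) al by move=> u v [].
have [_ /(_ _) join_xy] := modB _ be _ le_al x y.
have: cong_join (cong_meet al ga) (cong_meet be al) x y.
  apply: join_xy; split=> // th le_th be_th.
  apply: (ctrans (be_th _ _ be_xz)).
  exact: (ctrans (le_th _ _ (conj al_zw ga_zw)) (csym (be_th _ _ be_yw))).
by apply=> u v [] // ? ?; exact: le_ga.
Qed.

End ShiftingLemma.

(** * Displacement in the fibres of an extension *)

Section Shift.
Variables (S : signature) (V : variety S) (A : valgebra V) (M : abV A).

Definition pt (a : A) (m : M a) : total (ab_ov M) := existT (ab_ov M) a m.

Lemma pt_inj a : injective (@pt a).
Proof. by move=> m n e; exact: existT_inj e. Qed.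

(** Addition in the fibres respects equality in the total algebra, which compares
elements of fibres that are only propositionally the same. *)
Lemma ptD a b (m m' : M a) (n n' : M b) :
  pt m = pt n -> pt m' = pt n' -> pt (m + m') = pt (n + n').
Proof.
move=> e; have ab : a = b := congr1 (@projT1 _ _) e.
by case: b / ab n n' e => n n' /pt_inj -> /pt_inj ->.
Qed.

Section Extension.
Variable E : extension M.

(** The displacement is an element of the total algebra, so that no transport along
[ext_pi E e = a] appears when [m] lives over [a]. *)
Definition shift (e : E) (z : total (ab_ov M)) (x : E) : Prop :=
  exists2 m : M (ext_pi E e), z = pt m & x = sval (ext_chi E e m).

Lemma shift_src e z x : shift e z x -> ext_pi E e = projT1 z.
Proof. by case=> m -> _. Qed.

Lemma shift_tgt e z x : shift e z x -> ext_pi E x = projT1 z.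
Proof. by case=> m -> ->; rewrite /= -(svalP (ext_chi E e m)). Qed.

Lemma shift_fun e z x y : shift e z x -> shift e z y -> x = y.
Proof. by case=> m -> -> [n /pt_inj -> ->]. Qed.

Lemma shift_inj e z z' x : shift e z x -> shift e z' x -> z = z'.
Proof.
case=> m -> -> [n -> /sig_val_inj mn]; congr (pt _).
exact: (can_inj (iso_funK (ext_chi E) (a := e))) mn.
Qed.

Lemma shift_ex e a (m : M a) : ext_pi E e = a -> exists x, shift e (pt m) x.
Proof. by move=> ea; case: a / ea m => m; eexists; exists m. Qed.

Lemma shift_diff e x a :
  ext_pi E e = a -> ext_pi E x = a -> exists m : M a, shift e (pt m) x.
Proof.
move=> ea; case: a / ea => /esym ex.
exists (iso_inv (ext_chi E) e (exist _ x ex)); eexists; first by [].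
by rewrite iso_invK.
Qed.

Lemma shift0 e a : ext_pi E e = a -> shift e (pt (0 : M a)) e.
Proof.
move=> ea; case: a / ea; exists 0 => //.
exact: esym (congr1 sval (iso_point (ext_chi E) e)).
Qed.

(** Compatibility of [chi] with the operations. *)
Lemma shift_opn (w : S) (e x : 'I_(arity w) -> E) (z : 'I_(arity w) -> total (ab_ov M)) :
  (forall i, shift (e i) (z i) (x i)) -> shift (opn e) (opn z) (opn x).
Proof.
move=> /(_ _)/cid2 exm.
pose m i := let: exist2 m _ _ := exm i in m.
have -> : z = fun i => pt (m i).
  by apply: funext => i; rewrite /m; case: (exm i).
have -> : x = fun i => sval (ext_chi E (e i) (m i)).
  by apply: funext => i; rewrite /m; case: (exm i).
exists (oop (ab_ov (res (ext_pi E) M)) e m); first exact: esym (existT_res_op m).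
exact: esym (congr1 sval (ofun_op (ext_chi E) (a := e) m)).
Qed.

Lemma shift_eval n (t : term S n) (e x : 'I_n -> E) (z : 'I_n -> total (ab_ov M)) :
  (forall i, shift (e i) (z i) (x i)) -> shift (eval t e) (eval t z) (eval t x).
Proof. by move=> exz; elim: t => [i|w ts IH] //=; apply: shift_opn. Qed.

End Extension.

(** * Displacements add up *)

Section Additivity.
Variable E : extension M.

Let tcar : Type :=
  {t : (E * E * E)%type | ext_pi E t.1.1 = ext_pi E t.1.2 /\ ext_pi E t.1.1 = ext_pi E t.2}.

Lemma triple_op_subproof (w : S) (x : 'I_(arity w) -> tcar) :
  ext_pi E (opn (fun i => (sval (x i)).1.1)) = ext_pi E (opn (fun i => (sval (x i)).1.2)) /\
  ext_pi E (opn (fun i => (sval (x i)).1.1)) = ext_pi E (opn (fun i => (sval (x i)).2)).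
Proof.
by rewrite !hopn; split; congr opn; apply: funext => i; case: (svalP (x i)).
Qed.

Definition triple_algebra : algebra S :=
  @Algebra S tcar (fun w x => exist _
     (opn (fun i => (sval (x i)).1.1), opn (fun i => (sval (x i)).1.2),
      opn (fun i => (sval (x i)).2)) (triple_op_subproof x)).

Definition triple_fst : hom triple_algebra E :=
  @Hom S triple_algebra E (fun t => (sval t).1.1) (fun w x => erefl).
Definition triple_snd : hom triple_algebra E :=
  @Hom S triple_algebra E (fun t => (sval t).1.2) (fun w x => erefl).
Definition triple_trd : hom triple_algebra E :=
  @Hom S triple_algebra E (fun t => (sval t).2) (fun w x => erefl).

Lemma triple_ext (s t : triple_algebra) :
  triple_fst s = triple_fst t -> triple_snd s = triple_snd t ->
  triple_trd s = triple_trd t -> s = t.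
Proof.
case: s t => [[[s1 s2] s3] Ps] [[[t1 t2] t3] Pt] /= e1 e2 e3.
by apply: sig_val_inj; rewrite /= e1 e2 e3.
Qed.

Lemma triple_in_variety : in_variety V triple_algebra.
Proof.
move=> n s t Vst a.
by apply: triple_ext; rewrite !hom_eval; exact: valgP.
Qed.

(* The displacements [m], [n] and the two points [chi_e (m + n)] and
   [chi_(chi_e m) n] computed from a triple. *)
Let witness (a : A) : Type := (M a * M a * (E * E))%type.

(** For [t = (e, chi_e m, chi_e n)], the element [z] is the displacement from
[chi_(chi_e m) n] to [chi_e (m + n)]. *)
Definition defect (t : triple_algebra) (z : total (ab_ov M)) : Prop :=
  exists p : {a : A & witness a},
    [/\ shift (triple_fst t) (pt (projT2 p).1.1) (triple_snd t),
        shift (triple_fst t) (pt (projT2 p).1.2) (triple_trd t),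
        shift (triple_fst t) (pt ((projT2 p).1.1 + (projT2 p).1.2)) (projT2 p).2.1,
        shift (triple_snd t) (pt (projT2 p).1.2) (projT2 p).2.2
      & shift (projT2 p).2.2 z (projT2 p).2.1].

Lemma defect_ex t : exists z, defect t z.
Proof.
case: t => [[[e x] y] /= [ex ey]].
have [m em] := shift_diff erefl (esym ex).
have [n en] := shift_diff erefl (esym ey).
have [w ew] := shift_ex (m + n) erefl.
have [w' xw'] := shift_ex n (esym ex).
have [k w'w] := shift_diff (shift_tgt xw') (shift_tgt ew).
by exists (pt k), (existT witness _ (m, n, (w, w'))).
Qed.

Lemma defect_inj t z z' : defect t z -> defect t z' -> z = z'.
Proof.
case: t => [[[e x] y] /= et].
move=> [[a [[m n] [w w']]] /= [em en ew xw' w'w]].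
move=> [[b [[m1 n1] [w1 w1']]] /= [em1 en1 ew1 xw1' w1'w1]].
have Em := shift_inj em em1.
have ab : a = b := congr1 (@projT1 _ _) Em.
case: b / ab m1 n1 em1 en1 ew1 xw1' Em => m1 n1 em1 en1 ew1 xw1' /pt_inj Em.
have /pt_inj En := shift_inj en en1; subst m1 n1.
have Ew := shift_fun ew ew1; subst w1.
have Ew' := shift_fun xw' xw1'; subst w1'.
exact: shift_inj w'w w1'w1.
Qed.

Lemma defect_opn (w : S) (t : 'I_(arity w) -> triple_algebra)
    (z : 'I_(arity w) -> total (ab_ov M)) :
  (forall i, defect (t i) (z i)) -> defect (opn t) (opn z).
Proof.
move=> /choice [p pP].
exists (existT witness (opn (fun i => projT1 (p i)))
   (aop M _ (fun i => (projT2 (p i)).1.1), aop M _ (fun i => (projT2 (p i)).1.2),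
    (opn (fun i => (projT2 (p i)).2.1), opn (fun i => (projT2 (p i)).2.2)))).
split=> /=.
- apply: (shift_opn (z := fun i => pt (projT2 (p i)).1.1)) => i; by case: (pP i).
- apply: (shift_opn (z := fun i => pt (projT2 (p i)).1.2)) => i; by case: (pP i).
- rewrite -aopD.
  apply: (shift_opn (z := fun i => pt ((projT2 (p i)).1.1 + (projT2 (p i)).1.2))) => i.
  by case: (pP i).
- apply: (shift_opn (z := fun i => pt (projT2 (p i)).1.2)) => i; by case: (pP i).
- by apply: shift_opn => i; case: (pP i).
Qed.

#[local] Obligation Tactic := idtac.

(** Having the same defect: the kernel of the homomorphism that sends a triple to
its defect. *)
Program Definition defect_cong : congruence triple_algebra :=
  @Congruence S triple_algebra (fun t t' => exists z, defect t z /\ defect t' z) _ _ _ _.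
Next Obligation. by move=> t; have [z tz] := defect_ex t; exists z. Qed.
Next Obligation. by move=> t t' [z []]; exists z. Qed.
Next Obligation.
move=> t1 t2 t3 [z [z1 z2]] [z' [z2' z3]]; exists z; split=> //.
by rewrite (defect_inj z2 z2').
Qed.
Next Obligation.
move=> w t t' /choice [z zP]; exists (opn z).
by split; apply: defect_opn => i; case: (zP i).
Qed.

Hypothesis modV : congruence_modular V.

(** The triples with displacements [(0, 0)], [(m, 0)], [(0, n)] and [(m, n)] form a
parallelogram for the congruences that change only the second or only the third
entry, which meet trivially.  The first two triples have defect zero, so the
Shifting Lemma gives the last the defect of the third, which is zero too. *)
Lemma shift_add (e x y : E) a (m n : M a) :
  shift e (pt m) x -> shift x (pt n) y -> shift e (pt (m + n)) y.
Proof.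
move=> em xy; have ea := shift_src em; have xa := shift_tgt em; rewrite /= in ea xa.
have [y' en] := shift_ex n ea; have y'a := shift_tgt en.
have e0 := shift0 ea; have x0 := shift0 xa; have y'0 := shift0 y'a.
pose t00 : triple_algebra := exist _ (e, e, e) (conj erefl erefl).
pose t10 : triple_algebra := exist _ (e, x, e) (conj (etrans ea (esym xa)) erefl).
pose t01 : triple_algebra := exist _ (e, e, y') (conj erefl (etrans ea (esym y'a))).
pose t11 : triple_algebra :=
  exist _ (e, x, y') (conj (etrans ea (esym xa)) (etrans ea (esym y'a))).
have d00 : defect t00 (pt (0 : M a)).
  by exists (existT witness a (0, 0, (e, e))); rewrite /= addr0.
have d10 : defect t10 (pt (0 : M a)).
  by exists (existT witness a (m, 0, (x, x))); rewrite /= addr0.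
have d01 : defect t01 (pt (0 : M a)).
  by exists (existT witness a (0, n, (y', y'))); rewrite /= add0r.
have modC : modular_congruences triple_algebra := @modV (VAlgebra triple_in_variety).
have [z [z01 z11]] : defect_cong t01 t11.
  apply: (@shifting_lemma _ _ (cong_meet (ker triple_fst) (ker triple_trd))
    (cong_meet (ker triple_fst) (ker triple_snd)) _ _ _ t00 t10 modC) => //.
    move=> u v [uv1 uv3] [_ uv2]; rewrite (triple_ext uv1 uv2 uv3).
    exact: crefl.
  by exists (pt (0 : M a)).
move: z11; rewrite (defect_inj z01 d01) => -[[b [[m1 n1] [w w']]] /= [em1 en1 ew xw' w'w]].
have Em := shift_inj em em1.
have ab : a = b := congr1 (@projT1 _ _) Em.
case: b / ab m1 n1 em1 en1 ew xw' Em => m1 n1 em1 en1 ew xw' /pt_inj Em.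
have /pt_inj En := shift_inj en en1; subst m1 n1.
have <- : w = y; last by [].
(* the defect of [t11] is zero, so its two points [w] and [w'] agree *)
rewrite (shift_fun xy xw'); apply: shift_fun w'w (shift0 _).
exact: shift_tgt xw'.
Qed.

End Additivity.
End Shift.

(** * Factor sets and cocycles *)

Section FactorSetTheory.
Variables (S : signature) (V : variety S) (A : valgebra V) (M : abV A).

(** The second component of a term operation of the total algebra of [M], as
[tmapE] shows: the group homomorphism written [t^M_a]. *)
Fixpoint tmap n (t : term S n) (a : 'I_n -> A) (m : forall i, M (a i)) : M (eval t a) :=
  match t with
  | Var i => m i
  | App w ts => aop M _ (fun j => tmap (ts j) m)
  end.

Lemma tmapE n (t : term S n) (a : 'I_n -> A) (m : forall i, M (a i)) :
  eval t (fun i => pt (m i)) = pt (tmap t m).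
Proof.
elim: t => [//|w ts IH]; exact: (congr1 (@opn S _ w) (funext IH)).
Qed.

Lemma tmapD n (t : term S n) (a : 'I_n -> A) (m m' : forall i, M (a i)) :
  tmap t (fun i => m i + m' i) = tmap t m + tmap t m'.
Proof.
elim: t => [//|w ts IH] /=; rewrite -aopD; congr (aop M).
exact: functional_extensionality_dep.
Qed.

Lemma tmap0 n (t : term S n) (a : 'I_n -> A) : tmap t (fun i => 0 : M (a i)) = 0.
Proof.
apply: (addIr (tmap t (fun i => 0 : M (a i)))); rewrite add0r -tmapD; congr (tmap t).
by apply: functional_extensionality_dep => i; rewrite addr0.
Qed.

(** Factor families are indexed by classes of terms, for which no recursion is
available; their values on terms are used instead. *)
Definition on_term (f : factor_family M) n (t : term S n) (a : 'I_n -> A) : M (eval t a) :=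
  cast (P := fun a => M a) (clo_evalE t a) (f n (clo_class V t) a).

Lemma on_termE f n (t : term S n) a :
  pt (on_term f t a) = pt (f n (clo_class V t) a).
Proof. exact: (castE (P := fun a => M a : Type)). Qed.

Lemma clo_reprK n (v : Clo V n) : clo_class V (clo_repr v) = v.
Proof.
by apply: sig_val_inj; rewrite /= /clo_repr; case: cid.
Qed.

Lemma on_term_repr f n (v : Clo V n) a : on_term f (clo_repr v) a = f n v a.
Proof. by apply: pt_inj; rewrite on_termE clo_reprK. Qed.

Lemma on_term_identity f n (s t : term S n) a :
  V s t -> pt (on_term f s a) = pt (on_term f t a).
Proof.
move=> Vst; rewrite !on_termE; congr (pt (f n _ a)); apply: sig_val_inj => /=.
apply: funext => u; apply: propext.
have st (B : valgebra V) (b : 'I_n -> B) : eval s b = eval t b by exact: valgP.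
by split=> su B b; rewrite -su st.
Qed.

Lemma on_termD f g n (t : term S n) a :
  on_term (fun n v a => f n v a + g n v a) t a = on_term f t a + on_term g t a.
Proof. exact: castD. Qed.

(** The value at the operation [w] itself, as the class of the term
[w(x_1, ..., x_n)]. *)
Definition basic (f : factor_family M) (w : S) (a : 'I_(arity w) -> A) : M (opn a) :=
  on_term f (App (w := w) (@Var S _)) a.

(** The composition rule of factor sets, restricted to the composites from which all
terms are built; for a family indexed by classes of terms this is enough to be a
factor set. *)
Record cocycle (f : factor_family M) : Prop := Cocycle {
  cocycle_var : forall n (i : 'I_n) a, on_term f (Var S i) a = 0;
  cocycle_app : forall n (w : S) (ts : 'I_(arity w) -> term S n) a,
    on_term f (App ts) a = aop M _ (fun j => on_term f (ts j) a) +
      basic f (fun j => eval (ts j) a) }.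

Lemma cocycleD f g :
  cocycle f -> cocycle g -> cocycle (fun n v a => f n v a + g n v a).
Proof.
move=> [f0 fS] [g0 gS]; split=> [n i a|n w ts a].
  by rewrite on_termD f0 g0 addr0.
rewrite on_termD fS gS /basic on_termD addrACA; congr (_ + _).
rewrite -aopD; congr (aop M).
by apply: functional_extensionality_dep => j; rewrite on_termD.
Qed.

(** Difference by the coboundary of [d], written without subtraction so that it reads
as the equality of two ways from [sigma (v a)] to [v (sigma' a)], where [sigma' a]
is [sigma a] displaced by [d a]. *)
Definition cohomologous (f g : factor_family M) : Prop :=
  exists d : forall a, M a, forall n (v : Clo V n) a,
    f n v a + tmap (clo_repr v) (fun i => d (a i)) = d (clo_eval v a) + g n v a.

Lemma cohomologousD f f' g g' :
  cohomologous f f' -> cohomologous g g' ->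
  cohomologous (fun n v a => f n v a + g n v a) (fun n v a => f' n v a + g' n v a).
Proof.
move=> [d df] [e eg]; exists (fun a => d a + e a) => n v a.
by rewrite tmapD addrACA df eg addrACA.
Qed.

(** The relational form of [factor_set], free of transports and of the proof that
[sigma] is a section. *)
Definition has_factor_set (E : extension M) (sigma : A -> E) (f : factor_family M) :=
  forall n (v : Clo V n) a,
    shift (sigma (clo_eval v a)) (pt (f n v a)) (clo_eval v (fun i => sigma (a i))).

Lemma factor_setP (E : extension M) (sigma : A -> E)
    (sigmaP : cancel sigma (ext_pi E)) : has_factor_set sigma (factor_set sigmaP).
Proof.
move=> n v a; rewrite /factor_set.
exists (iso_inv (ext_chi E) (sigma (clo_eval v a))
   (exist _ (clo_eval v (fun i => sigma (a i))) (factor_set_subproof sigmaP v a))).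
  exact: (castE (P := fun a => M a : Type)).
by rewrite iso_invK.
Qed.

Lemma has_factor_setP (E : extension M) (sigma : A -> E) (f : factor_family M) :
  cancel sigma (ext_pi E) -> has_factor_set sigma f -> represents (class_of E) f.
Proof.
move=> sigmaP fP; exists E, sigma, sigmaP; split=> // n v a.
exact/pt_inj/(shift_inj (factor_setP sigmaP v a))/fP.
Qed.

Lemma has_factor_set_term (E : extension M) (sigma : A -> E) f n (t : term S n) a :
  has_factor_set sigma f ->
  shift (sigma (eval t a)) (pt (on_term f t a)) (eval t (fun i => sigma (a i))).
Proof.
move=> /(_ n (clo_class V t) a); rewrite -on_termE.
by move: (on_term f t a); rewrite !clo_evalE.
Qed.

Lemma has_factor_set_basic (E : extension M) (sigma : A -> E) f (w : S)
    (a : 'I_(arity w) -> A) :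
  has_factor_set sigma f ->
  shift (sigma (opn a)) (pt (basic f a)) (opn (fun i => sigma (a i))).
Proof. exact: (has_factor_set_term (App (w := w) (@Var S _)) a). Qed.

(** An equivalence is a homomorphism that preserves displacements; compatibility
with the projections is part of this, by displacement by zero. *)
Lemma equivalentP (E E' : extension M) :
  equivalent E E' <-> exists g : hom E E', forall e z x, shift e z x -> shift (g e) z (g x).
Proof.
split=> [[g [gP gchi]]|[g gS]]; exists g.
  move=> e _ _ [m -> ->]; rewrite gchi.
  by exists (cast (P := fun a => M a) (gP e) m); rewrite // /pt castE.
have gP e : ext_pi E e = ext_pi E' (g e).
  by have /gS/shift_src := shift0 (erefl (ext_pi E e)).
exists gP => e m.
have /gS em : shift e (pt m) (sval (ext_chi E e m)) by exists m.
apply: shift_fun em _; exists (cast (P := fun a => M a) (gP e) m) => //.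
by rewrite /pt castE.
Qed.

Lemma equivalent_refl (E : extension M) : equivalent E E.
Proof. by apply/equivalentP; exists (@Hom S E E id (fun w a => erefl)). Qed.

Lemma equivalent_trans (E E' E'' : extension M) :
  equivalent E E' -> equivalent E' E'' -> equivalent E E''.
Proof.
move=> /equivalentP[g gS] /equivalentP[h hS]; apply/equivalentP.
have ghP (w : S) (a : 'I_(arity w) -> E) :
  h (g (opn a)) = opn (fun i => h (g (a i))) by rewrite !hopn.
by exists (@Hom S E E'' (fun e => h (g e)) ghP) => e z x /gS/hS.
Qed.

Lemma class_of_eq (E E' : extension M) :
  equivalent E E' -> equivalent E' E -> class_of E = class_of E'.
Proof.
move=> EE' E'E; apply: sig_val_inj; apply: funext => E''; apply: propext.
by split; apply: equivalent_trans.
Qed.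

(** [represents] only provides a section of some equivalent extension; the
equivalence carries it to [E] with the same factor set. *)
Lemma representsE (E : extension M) f :
  represents (class_of E) f ->
  exists2 sigma : A -> E, cancel sigma (ext_pi E) & has_factor_set sigma f.
Proof.
move=> [E' [sigma [sigmaP [/(congr1 sval) /= eqE fE]]]].
have /equivalentP[g gS] : equivalent E' E by rewrite -eqE; exact: equivalent_refl.
exists (fun a => g (sigma a)) => [a|n v a].
  have /gS/shift_src /= -> := shift0 (erefl (ext_pi E' (sigma a))).
  exact: sigmaP.
by rewrite -hom_clo_eval; apply: gS; rewrite -fE; exact: factor_setP.
Qed.

Lemma class_of_ex (c : ext_class M) : exists E, c = class_of E.
Proof. by case: c => c [E cE]; exists E; apply: sig_val_inj. Qed.

Lemma represents_ex (c : ext_class M) : exists f, represents c f.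
Proof.
have [E ->] := class_of_ex c; have /choice[sigma sigmaP] := ext_onto E.
by exists (factor_set (sigmaP : cancel _ _)), E, sigma, sigmaP.
Qed.

Hypothesis modV : congruence_modular V.

(** Both sides displace [sigma (t a)] to [t (sigma a)]: directly, or first along the
outermost operation and then along its arguments. *)
Lemma represents_cocycle c f : represents c f -> cocycle f.
Proof.
have [E ->] := class_of_ex c => /representsE[s sP fP].
split=> [n i a|n w ts a]; apply: pt_inj.
  exact: (shift_inj (has_factor_set_term (Var S i) a fP)) (shift0 (sP _)).
apply: (shift_inj (has_factor_set_term (App ts) a fP)); rewrite addrC.
apply: (shift_add modV (has_factor_set_basic (fun j => eval (ts j) a) fP)).
apply: (shift_opn (z := fun j => pt (on_term f (ts j) a))) => j.
exact: has_factor_set_term.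
Qed.

(** The cochain is the displacement from one section to the other. *)
Lemma represents_cohomologous c f f' :
  represents c f -> represents c f' -> cohomologous f f'.
Proof.
have [E ->] := class_of_ex c => /representsE[s sP fP] /representsE[s' s'P f'P].
pose d a := projT1 (cid (shift_diff (sP a) (s'P a))).
have dP a : shift (s a) (pt (d a)) (s' a) by rewrite /d; case: cid.
exists d => n v a; apply: pt_inj.
have vd : shift (clo_eval v (fun i => s (a i)))
    (pt (tmap (clo_repr v) (fun i => d (a i)))) (clo_eval v (fun i => s' (a i))).
  by rewrite -tmapE; exact: shift_eval.
exact: (shift_inj (shift_add modV (fP n v a) vd) (shift_add modV (dP _) (f'P n v a))).
Qed.

(** Displacing the section by the cochain realises the change of factor set. *)
Lemma cohomologous_represents c f f' :
  represents c f -> cohomologous f f' -> represents c f'.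
Proof.
have [E ->] := class_of_ex c => /representsE[s sP fP] [d dP].
have /choice[s' s'P] a := shift_ex (d a) (sP a).
apply: (has_factor_setP (sigma := s')) => [a|n v a]; first exact: shift_tgt (s'P a).
have s'K a : ext_pi E (s' a) = a := shift_tgt (s'P a).
have vd : shift (clo_eval v (fun i => s (a i)))
    (pt (tmap (clo_repr v) (fun i => d (a i)))) (clo_eval v (fun i => s' (a i))).
  by rewrite -tmapE; exact: shift_eval.
have [y s'y] := shift_ex (f' n v a) (s'K _).
have := shift_add modV (s'P _) s'y; rewrite -dP => sy.
by rewrite (shift_fun (shift_add modV (fP n v a) vd) sy).
Qed.

(** Each element of [E] is [s a] displaced by a unique [m]; the equivalence sends it
to [s' a] displaced by the same [m].  The operations are determined by [M] and the
factor set, hence are preserved. *)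
Lemma has_factor_set_equivalent (E E' : extension M) (s : A -> E) (s' : A -> E') f :
  cancel s (ext_pi E) -> cancel s' (ext_pi E') ->
  has_factor_set s f -> has_factor_set s' f -> equivalent E E'.
Proof.
move=> sP s'P fP f'P.
(* the graph of the equivalence *)
pose G e x := exists2 m : M (ext_pi E e),
  shift (s (ext_pi E e)) (pt m) e & shift (s' (ext_pi E e)) (pt m) x.
have G_ex e : exists x, G e x.
  have [m me] := shift_diff (sP (ext_pi E e)) erefl.
  by have [x mx] := shift_ex m (s'P (ext_pi E e)); exists x, m.
have G_fun e x y : G e x -> G e y -> x = y.
  move=> [m me mx] [n ne ny].
  have /pt_inj mn := shift_inj me ne; subst n.
  exact: shift_fun mx ny.
have G_opn (w : S) e x : (forall i, G (e i) (x i)) -> G (@opn S E w e) (opn x).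
  move=> /(_ _)/cid2 Gex.
  pose a i := ext_pi E (e i).
  pose m i : M (a i) := projT1 (Gex i).
  have se : shift (opn (fun i => s (a i))) (pt (aop M a m)) (opn e).
    by apply: (shift_opn (z := fun i => pt (m i))) => i; rewrite /m; case: (Gex i).
  have se' : shift (opn (fun i => s' (a i))) (pt (aop M a m)) (opn x).
    by apply: (shift_opn (z := fun i => pt (m i))) => i; rewrite /m; case: (Gex i).
  rewrite /G hopn; exists (basic f a + aop M a m).
    exact: (shift_add modV (has_factor_set_basic a fP) se).
  exact: (shift_add modV (has_factor_set_basic a f'P) se').
have /choice[g gP] := G_ex.
have gopn (w : S) (e : 'I_(arity w) -> E) : g (opn e) = opn (fun i => g (e i)).
  by apply: G_fun (gP _) _; exact: G_opn.
apply/equivalentP; exists (@Hom S E E' g gopn) => e z x exz /=.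
have [m se se'] := gP e.
have [n zn _] := exz; subst z; have ex := shift_tgt exz; rewrite /= in ex.
have [y ey] := shift_ex n (shift_tgt se').
rewrite (_ : g x = y) //; apply: G_fun (gP x) _.
rewrite /G ex; exists (m + n).
  exact: (shift_add modV se exz).
exact: (shift_add modV se' ey).
Qed.

Lemma represents_inj (c c' : ext_class M) f : represents c f -> represents c' f -> c = c'.
Proof.
have [E ->] := class_of_ex c; have [E' ->] := class_of_ex c'.
move=> /representsE[s sP fP] /representsE[s' s'P f'P].
by apply: class_of_eq;
  [apply: has_factor_set_equivalent fP f'P|apply: has_factor_set_equivalent f'P fP].
Qed.

End FactorSetTheory.

(** * The extension defined by a cocycle *)

Section TwistedProduct.
Variables (S : signature) (V : variety S) (A : valgebra V) (M : abV A).
Variables (f : factor_family M) (fP : cocycle f).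

(** The total algebra of [M] with [f] added to its basic operations. *)
Definition twisted_algebra : algebra S :=
  @Algebra S {a : A & M a} (fun w z =>
    pt (aop M (fun i => projT1 (z i)) (fun i => projT2 (z i)) +
        basic f (fun i => projT1 (z i)))).

Definition tw a (m : M a) : twisted_algebra := pt m.

(** The cocycle condition propagates the twist from basic operations to terms. *)
Lemma twisted_eval n (t : term S n) (a : 'I_n -> A) (m : forall i, M (a i)) :
  eval t (fun i => tw (m i)) = tw (tmap t m + on_term f t a).
Proof.
elim: t => [i|w ts IH]; first by rewrite cocycle_var // addr0.
apply: etrans (congr1 (@opn S twisted_algebra w) (funext IH)) _.
by rewrite cocycle_app // addrA -aopD.
Qed.

(** An identity of [V] holds for the first summand because the total algebra of [M]
is in [V], and for the second because [f] depends only on the class of a term. *)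
Lemma twisted_in_variety : in_variety V twisted_algebra.
Proof.
move=> n s t Vst z.
have -> : z = fun i => tw (projT2 (z i)) by apply: funext => i; case: (z i).
rewrite !twisted_eval; apply: ptD; last exact: on_term_identity.
by rewrite -!tmapE; exact: abV_total.
Qed.

Definition twisted_pi : hom twisted_algebra A :=
  @Hom S twisted_algebra A (fun z => projT1 z) (fun w z => erefl).

Lemma twisted_onto a : exists z, twisted_pi z = a.
Proof. by exists (tw (0 : M a)). Qed.

Definition twisted_chi_fun (z : twisted_algebra) (m : M (projT1 z)) :
  star (ker twisted_pi) z := exist _ (tw (projT2 z + m)) erefl.

Definition twisted_chi_inv (z : twisted_algebra) (y : star (ker twisted_pi) z) :
    M (projT1 z) :=
  cast (P := fun a => M a) (esym (svalP y)) (projT2 (sval y)) - projT2 z.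

Lemma twisted_chi_op (w : S) (z : 'I_(arity w) -> twisted_algebra)
    (m : forall i, M (projT1 (z i))) :
  twisted_chi_fun (z := opn z) (oop (ab_ov (res twisted_pi M)) z m) =
  oop (star (ker twisted_pi)) z (fun i => twisted_chi_fun (m i)).
Proof. by apply: sig_val_inj; congr pt; rewrite /= aopD addrAC. Qed.

Lemma twisted_chi_point (z : twisted_algebra) :
  twisted_chi_fun (0 : M (projT1 z)) = point (star (ker twisted_pi)) z.
Proof. by apply: sig_val_inj; case: z => a m; rewrite /= addr0. Qed.

Lemma twisted_chi_funK z : cancel (@twisted_chi_fun z) (@twisted_chi_inv z).
Proof.
move=> m; rewrite /twisted_chi_inv (Prop_irrelevance (esym _) erefl) /=.
by rewrite [X in X - _]addrC addrK.
Qed.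

Lemma twisted_chi_invK z : cancel (@twisted_chi_inv z) (@twisted_chi_fun z).
Proof.
move=> y; apply: sig_val_inj; rewrite /= /twisted_chi_inv addrC subrK.
rewrite /tw /pt; exact: etrans (castE (P := fun a => M a : Type) _ _) (esym (sigT_eta _)).
Qed.

Definition twisted_extension : extension M :=
  @Extension S V A M (VAlgebra twisted_in_variety) twisted_pi twisted_onto
    (@PointedIso S twisted_algebra (ab_pointed (res twisted_pi M)) (star (ker twisted_pi))
      (@OHom S twisted_algebra (ab_ov (res twisted_pi M)) (star_overalgebra (ker twisted_pi))
         twisted_chi_fun twisted_chi_op) twisted_chi_point
      twisted_chi_inv twisted_chi_funK twisted_chi_invK).

(** The zero section has factor set [f]. *)
Lemma represents_twisted : represents (class_of twisted_extension) f.
Proof.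
apply: (has_factor_setP (E := twisted_extension) (sigma := fun a => tw (0 : M a))) => // n v a.
exists (f v a) => //.
by rewrite /clo_eval twisted_eval tmap0 /= !add0r on_term_repr.
Qed.

End TwistedProduct.

(** * The group of extensions *)

Section Abelian.
Variables (S : signature) (V : variety S) (modV : congruence_modular V).
Variables (A : valgebra V) (M : abV A).

Lemma eq_represents (c : ext_class M) f g :
  represents c f -> (forall n (v : Clo V n) a, f n v a = g n v a) -> represents c g.
Proof.
move=> [E [s [sP [cE sf]]]] fg; exists E, s, sP; split=> // n v a.
by rewrite sf fg.
Qed.

Lemma cocycle_hom (N : abV A) (g : ab_hom M N) f :
  cocycle f -> cocycle (M := N) (fun n v a => g _ (f n v a)).
Proof.
have castg n (t : term S n) a :
    on_term (M := N) (fun n v a => g _ (f n v a)) t a = g _ (on_term f t a).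
  by rewrite /on_term; case: _ / (clo_evalE t a).
have g0 a : g a (0 : M a) = 0 :> N a.
  by apply: (addIr (g a 0 : N a)); rewrite -ahomD !add0r.
move=> [f0 fS]; split=> [n i a|n w ts a].
  by rewrite castg f0 g0.
rewrite castg fS ahomD /basic castg; congr (_ + _).
apply: etrans (ofun_op g (fun j => on_term f (ts j) a)) _ => /=; congr (aop N).
by apply: functional_extensionality_dep => j; rewrite castg.
Qed.

Lemma tmap_hom (N : abV A) (g : ab_hom M N) n (t : term S n) (a : 'I_n -> A)
    (m : forall i, M (a i)) :
  g _ (tmap t m) = tmap (M := N) t (fun i => g _ (m i)).
Proof.
elim: t => [//|w ts IH] /=.
apply: etrans (ofun_op g (fun j => tmap (ts j) m)) _ => /=; congr (aop N).
exact: functional_extensionality_dep.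
Qed.

Lemma cohomologous_hom (N : abV A) (g : ab_hom M N) f f' :
  cohomologous f f' ->
  cohomologous (M := N) (fun n v a => g _ (f n v a)) (fun n v a => g _ (f' n v a)).
Proof.
move=> [d dP]; exists (fun a => g a (d a)) => n v a.
by rewrite -tmap_hom -!ahomD dP.
Qed.

Lemma cocycle0 : cocycle (fun n (v : Clo V n) a => 0 : M (clo_eval v a)).
Proof.
have on0 n (t : term S n) a :
    on_term (fun n (v : Clo V n) a => 0 : M (clo_eval v a)) t a = 0.
  by rewrite /on_term; case: _ / (clo_evalE t a).
split=> [n i a|n w ts a]; rewrite /basic !on0 // addr0.
rewrite -[LHS](tmap0 M (App (w := w) (@Var S _)) (fun j => eval (ts j) a)) /=.
by congr (aop M); apply: functional_extensionality_dep => j; rewrite on0.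
Qed.

Lemma cocycleN f : cocycle f -> cocycle (M := M) (fun n v a => - f n v a).
Proof.
move=> [f0 fS].
have onN n (t : term S n) a : on_term (M := M) (fun n v a => - f n v a) t a = - on_term f t a.
  by rewrite /on_term; case: _ / (clo_evalE t a).
split=> [n i a|n w ts a]; first by rewrite onN f0 oppr0.
rewrite onN fS opprD /basic onN; congr (_ + _); apply/eqP.
rewrite eq_sym -addr_eq0 -aopD; apply/eqP.
rewrite -[RHS](tmap0 M (App (w := w) (@Var S _)) (fun j => eval (ts j) a)) /=.
by congr (aop M); apply: functional_extensionality_dep => j; rewrite onN addNr.
Qed.

Definition rep (c : ext_class M) : factor_family M := projT1 (cid (represents_ex c)).

Lemma repP c : represents c (rep c).
Proof. by rewrite /rep; case: cid. Qed.

Definition cocycle_class_of f (fP : cocycle f) : ext_class M :=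
  class_of (twisted_extension fP).

Let repC c : cocycle (rep c) := represents_cocycle modV (repP c).

(** Addition of chosen factor sets; [represents_add] shows that the choice is
immaterial. *)
Definition ext_add (c c' : ext_class M) : ext_class M :=
  cocycle_class_of (cocycleD (repC c) (repC c')).
Definition ext_zero : ext_class M := cocycle_class_of cocycle0.
Definition ext_opp (c : ext_class M) : ext_class M := cocycle_class_of (cocycleN (repC c)).

Lemma represents_add (c c' : ext_class M) f f' : represents c f -> represents c' f' ->
  represents (ext_add c c') (fun n v a => f n v a + f' n v a).
Proof.
move=> cf c'f'; apply: (cohomologous_represents modV (represents_twisted _)).
apply: cohomologousD; exact: (represents_cohomologous modV (repP _)).
Qed.

Lemma represents_eq (c c' : ext_class M) f f' : represents c f -> represents c' f' ->
  (forall n (v : Clo V n) a, f n v a = f' n v a) -> c = c'.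
Proof. by move=> cf c'f' /(eq_represents cf) cf'; exact: represents_inj cf' c'f'. Qed.

Lemma ext_addA : associative ext_add.
Proof.
move=> c c' c''; have [cP cP' cP''] := And3 (repP c) (repP c') (repP c'').
apply: represents_eq (represents_add cP (represents_add cP' cP''))
  (represents_add (represents_add cP cP') cP'') _ => n v a.
exact: addrA.
Qed.

Lemma ext_addC : commutative ext_add.
Proof.
move=> c c'; have [cP cP'] := conj (repP c) (repP c').
apply: represents_eq (represents_add cP cP') (represents_add cP' cP) _ => n v a.
exact: addrC.
Qed.

Lemma ext_add0 : left_id ext_zero ext_add.
Proof.
move=> c; apply: represents_eq (represents_add (represents_twisted _) (repP c)) (repP c) _.
by move=> n v a; exact: add0r.
Qed.

Lemma ext_addN : left_inverse ext_zero ext_opp ext_add.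
Proof.
move=> c; apply: represents_eq (represents_add (represents_twisted _) (repP c))
  (represents_twisted _) _.
by move=> n v a; exact: addNr.
Qed.

Definition ext_law : ab_law (ext_class M) := AbLaw ext_addA ext_addC ext_add0 ext_addN.

Lemma ext_law_factor_sets : factor_set_addition ext_law.
Proof. by move=> c c' f f'; exact: represents_add. Qed.

(** Applying [g] to factor sets is well defined on classes since it preserves
cocycles and coboundaries. *)
Lemma postcomp_ex (N : abV A) (g : ab_hom M N) (c : ext_class M) :
  exists c' : ext_class N, forall f, represents c f ->
    represents c' (fun n v a => g _ (f n v a)).
Proof.
exists (class_of (twisted_extension (cocycle_hom g (repC c)))) => f cf.
apply: (cohomologous_represents modV (represents_twisted _)).
exact/cohomologous_hom/(represents_cohomologous modV (repP c)).
Qed.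

End Abelian.

(** * Pullback along a homomorphism *)

Section Pulling.
Variables (S : signature) (V : variety S) (A A' : valgebra V) (g : hom A' A).
Variable M : abV A.

Definition pull_family (f : factor_family M) : factor_family (resV g M) :=
  fun n v a => cast (P := fun a => M a) (esym (hom_clo_eval g v a))
                 (f n v (fun i => g (a i))).

Lemma pull_familyE f n (v : Clo V n) a :
  pt (M := M) (a := g (clo_eval v a)) (pull_family f v a) =
  pt (f n v (fun i => g (a i))).
Proof. exact: (castE (P := fun a => M a : Type)). Qed.

Lemma shift_pullback (E : extension M) (x y : pullback g E)
    (m : M (g (ext_pi (pullback g E) x))) :
  ext_pi (pullback g E) x = ext_pi (pullback g E) y ->
  shift (pull_fst g E x) (pt m) (pull_fst g E y) -> shift x (pt (M := resV g M) m) y.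
Proof.
move=> xy mxy; exists m => //; apply: sig_val_inj.
rewrite [LHS]surjective_pairing; congr pair; last exact: esym xy.
apply: shift_fun mxy _; exists (pull_coef (x := x) m) => //.
exact: esym (castE (P := fun a => M a : Type) _ _).
Qed.

(** A section [s] of [E] induces the section [a' |-> (s (g a'), a')] of the
pullback. *)
Lemma represents_pullback (E : extension M) f :
  represents (class_of E) f -> represents (class_of (pullback g E)) (pull_family f).
Proof.
move=> /representsE[s sP fP].
pose s' a' : pullback g E := exist _ (s (g a'), a') (sP (g a')).
apply: (has_factor_setP (sigma := s')) => // n v a.
have s1 : pull_fst g E (clo_eval v (fun i => s' (a i))) = clo_eval v (fun i => s (g (a i))).
  exact: (hom_clo_eval (A := pullback g E) (B := E) (pull_fst g E)).
have s2 : ext_pi (pullback g E) (clo_eval v (fun i => s' (a i))) = clo_eval v a.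
  exact: (hom_clo_eval (A := pullback g E)).
apply: shift_pullback; first exact: esym s2.
rewrite s1 pull_familyE /= hom_clo_eval; exact: fP.
Qed.

End Pulling.

Lemma represents_recoef (S : signature) (V : variety S) (A : valgebra V) (M N : abV A)
    (i : ab_iso M N) (E : extension M) f :
  represents (class_of E) f ->
  represents (class_of (recoef i E)) (fun n v a => i _ (f n v a)).
Proof.
move=> /representsE[s sP fP].
apply: (has_factor_setP (E := recoef i E) sP) => n v a.
have [m fm xm] := fP n v a; exists (i _ m); last by rewrite /= ab_iso_funK.
exact: (congr1 (fun z : total (ab_ov M) => pt (M := N) (i _ (projT2 z))) fm).
Qed.

(** * The bifunctor *)

Section Functor.
Variables (S : signature) (V : variety S) (modV : congruence_modular V) (A : valgebra V).

Definition EV_law (Q : ovV A) (M : abV A) : ab_law (EV Q M) := ext_law modV (coef Q M).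

Definition factor_precomp (Q Q' : ovV A) (M : abV A) (r : ohom Q' Q)
    (f : factor_family (coef Q M)) : factor_family (coef Q' M) :=
  fun n v a => pull_family (A := totalV Q) (A' := totalV Q') (M := coef Q M)
                 (total_hom r) f v a.

Lemma represents_precomp (Q Q' : ovV A) (M : abV A) (r : ohom Q' Q)
    (E : extension (coef Q M)) f :
  represents (class_of E) f -> represents (class_of (ext_precomp E r)) (factor_precomp r f).
Proof.
move=> Ef; apply: (represents_recoef (res_total r M)).
exact: (represents_pullback (A := totalV Q) (A' := totalV Q') (total_hom r) Ef).
Qed.

Definition factor_push (Q Q' : ovV A) (M M' : abV A) (r : ohom Q' Q) (g : ab_hom M M')
    (f : factor_family (coef Q M)) : factor_family (coef Q' M') :=
  factor_postcomp g (factor_precomp r f).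

Lemma push_ex (Q Q' : ovV A) (M M' : abV A) (r : ohom Q' Q) (g : ab_hom M M')
    (c : EV Q M) :
  exists c' : EV Q' M', forall f, represents c f -> represents c' (factor_push r g f).
Proof.
have [E ->] := class_of_ex c.
have [c' c'P] := postcomp_ex modV (A := totalV Q') (M := coef Q' M) (N := coef Q' M')
  (res_hom (total_proj Q') g) (class_of (ext_precomp E r)).
by exists c' => f /(represents_precomp r)/c'P.
Qed.

(** The action of the pair [(r, g)], characterised by [represents_push]: factor sets
are reindexed along [r] and mapped by [g]. *)
Definition push (Q Q' : ovV A) (M M' : abV A) (r : ohom Q' Q) (g : ab_hom M M')
  (c : EV Q M) : EV Q' M' := projT1 (cid (push_ex r g c)).

Lemma represents_push (Q Q' : ovV A) (M M' : abV A) (r : ohom Q' Q) (g : ab_hom M M')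
    (c : EV Q M) f :
  represents c f -> represents (push r g c) (factor_push r g f).
Proof. by rewrite /push; case: cid => c' /=; apply. Qed.

(** Equalities between classes are checked on one factor set. *)
Lemma push_eq (Q Q' : ovV A) (M M' : abV A) (r : ohom Q' Q) (g : ab_hom M M')
    (c : EV Q M) f (c' : EV Q' M') f' :
  represents c f -> represents c' f' ->
  (forall n (v : Clo V n) a, factor_push r g f v a = f' n v a) -> push r g c = c'.
Proof. by move=> /(represents_push r g); exact: represents_eq. Qed.

Lemma pushD (Q Q' : ovV A) (M M' : abV A) (r : ohom Q' Q) (g : ab_hom M M') c c' :
  push r g (gadd (EV_law Q M) c c') = gadd (EV_law Q' M') (push r g c) (push r g c').
Proof.
have [f cf] := represents_ex c; have [f' cf'] := represents_ex c'.
apply: push_eq (represents_add modV cf cf')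
  (represents_add modV (represents_push r g cf) (represents_push r g cf')) _ => n v a.
rewrite /factor_push /factor_postcomp -ahomD; congr (ahom _ _).
by rewrite /factor_precomp /pull_family castD.
Qed.

(** The transport of the reindexed family disappears in the total algebra. *)
Lemma factor_push_val (Q Q' : ovV A) (M M' : abV A) (r : ohom Q' Q) (g : ab_hom M M')
    f n (v : Clo V n) a :
  pt (M := M') (factor_push r g f v a) =
  pt (M := M') (g _ (f n v (fun i => total_hom r (a i)))).
Proof.
exact: (congr1 (fun z : total (ab_ov (coef Q M)) => pt (M := M') (g _ (projT2 z)))
  (pull_familyE (A := totalV Q) (A' := totalV Q') (total_hom r) f v a)).
Qed.

Lemma push_id (Q : ovV A) (M : abV A) (c : EV Q M) :
  push (oid Q) (ab_hom_id M) c = c.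
Proof.
have [f cf] := represents_ex c; apply: (push_eq cf cf) => n v a.
apply: (@pt_inj S V A M (projT1 (clo_eval v a))).
rewrite factor_push_val /=.
by rewrite (_ : (fun i => _) = a) //; apply: funext => i; case: (a i).
Qed.

Lemma push_comp (Q Q' Q'' : ovV A) (M M' M'' : abV A) (r : ohom Q' Q) (r' : ohom Q'' Q')
    (g : ab_hom M M') (g' : ab_hom M' M'') (c : EV Q M) :
  push (ocomp r r') (ab_hom_comp g' g) c = push r' g' (push r g c).
Proof.
have [f cf] := represents_ex c.
apply: (push_eq cf (represents_push r' g' (represents_push r g cf))) => n v a.
apply: (@pt_inj S V A M'' (projT1 (clo_eval v a))).
rewrite [LHS]factor_push_val [RHS]factor_push_val /=.
exact: (congr1 (fun z : total (ab_ov M') => pt (M := M'') (g' _ (projT2 z)))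
  (esym (factor_push_val r g f v (fun i => total_hom r' (a i))))).
Qed.

Definition push_hom (Q Q' : ovV A) (M M' : abV A) (r : ohom Q' Q) (g : ab_hom M M') :
  ab_group_hom (AbGroup (EV_law Q M)) (AbGroup (EV_law Q' M')) :=
  @AbGroupHom (AbGroup (EV_law Q M)) (AbGroup (EV_law Q' M')) (push r g) (pushD r g).

Definition EV_functor :
  functor (C := prod_cat (op_cat (Ov A)) (Ab A)) (D := ab_group_cat)
    (fun QM => AbGroup (EV_law QM.1 QM.2)) :=
  @Functor (prod_cat (op_cat (Ov A)) (Ab A)) ab_group_cat
    (fun QM => AbGroup (EV_law QM.1 QM.2))
    (fun QM QM' h => push_hom h.1 h.2)
    (fun QM => ab_group_hom_ext
       (f := push_hom (oid QM.1) (ab_hom_id QM.2)) (g := ab_group_id _) (@push_id QM.1 QM.2))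
    (fun QM QM' QM'' h' h => ab_group_hom_ext
       (f := push_hom (ocomp h.1 h'.1) (ab_hom_comp h'.2 h.2))
       (g := ab_group_comp (push_hom h'.1 h'.2) (push_hom h.1 h.2))
       (push_comp h.1 h'.1 h.2 h'.2)).

End Functor.

Theorem mainTheorem4 (S : signature) (V : variety S)
    (modV : congruence_modular V) (A : valgebra V) :
  exists G : forall (Q : Ov A) (M : Ab A), ab_law (EV Q M),
    (forall (Q : Ov A) (M : Ab A), factor_set_addition (G Q M)) /\
    exists F : functor (C := prod_cat (op_cat (Ov A)) (Ab A)) (D := ab_group_cat)
                 (fun QM => AbGroup (G QM.1 QM.2)),
      (forall (Q Q' : Ov A) (M : Ab A) (r : mor Q' Q)
              (E : extension (coef Q M)),
         F (Q, M) (Q', M) (r, idm M) (class_of E) = class_of (ext_precomp E r)) /\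
      (forall (Q : Ov A) (M M' : Ab A) (g : mor M M') (c : EV Q M)
              (f : factor_family (coef Q M)),
         represents c f ->
         represents (F (Q, M) (Q, M') (idm Q, g) c) (factor_postcomp g f)).
Proof.
exists (EV_law modV (A := A)); split=> [Q M|]; first exact: ext_law_factor_sets.
exists (EV_functor modV A); split=> [Q Q' M r E|Q M M' g c f cf].
  have [f Ef] := represents_ex (class_of E).
  exact: (push_eq modV Ef (represents_precomp r Ef)).
apply: eq_represents (represents_push modV (oid Q) g cf) _ => n v a.
apply: (@pt_inj S V A M' (projT1 (clo_eval v a))); rewrite factor_push_val /factor_postcomp /=.
by rewrite (_ : (fun i => _) = a) //; apply: funext => i; case: (a i).
Qed.
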